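(* For any multisorted algebraic language $\mathcal{G}$ with no nullary symbols and finitely many sorts, the category $\mathsf{MSAlg}^+(\mathcal{G})$ of multisorted $\mathcal{G}$-algebras is equivalent to the category $\overline{\mathsf{DAlg}}^{\,+}(\hat{\mathcal{G}})$ of $\hat{\mathcal{G}}$-algebras. In more detail: (1) the functor $\mathfrak{P}$ maps the full subcategory $\mathsf{MSAlg}^+(\mathcal{G})$ of $\mathsf{MSAlg}(\mathcal{G})$ into the full subcategory $\mathsf{DAlg}^+(\hat{\mathcal{G}})$ of $\mathsf{Alg}(\hat{\mathcal{G}})$, and yields (by changing the domain and target categories) an isomorphism $\mathfrak{P}\colon\mathsf{MSAlg}^+(\mathcal{G})\to\mathsf{DAlg}^+(\hat{\mathcal{G}})$; (2) $\mathfrak{P}$ restricts to an isomorphism between the full subcategory $\mathsf{MSAlg}^\boxplus(\mathcal{G})$ of $\mathsf{MSAlg}^+(\mathcal{G})$ and the full subcategory $\mathsf{DAlg}^\boxplus(\hat{\mathcal{G}})$ of $\mathsf{DAlg}^+(\hat{\mathcal{G}})$.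
   Context: $\mathcal{G}$ is a multisorted algebraic language with no nullary symbols whose sorts are indexed by $[m]=\{1,\dots,m\}$, $m>0$. $\hat{\mathcal{G}}$ is the (single-sorted) language with an $m$-ary symbol $d$ and a symbol $\hat{g}$ with $\mathrm{ar}(\hat{g})=\mathrm{ar}(g)$ for each $g\in\mathcal{G}$. The functor $\mathfrak{P}\colon\mathsf{MSAlg}(\mathcal{G})\to\mathsf{Alg}(\hat{\mathcal{G}})$ sends a multisorted algebra $\mathbf{M}=((M^{(i)})_{i\in[m]};\mathcal{G})$ to the $\hat{\mathcal{G}}$-algebra on $M^{(1)}\times\dots\times M^{(m)}$ in which $d$ is the diagonal operation $d((a_1^{(i)})_i,\dots,(a_m^{(i)})_i)=(a_1^{(1)},\dots,a_m^{(m)})$, and for $g\in\mathcal{G}$ with input sorts $(i_1,\dots,i_k)$ and output sort $i'$, $\hat{g}((a_1^{(i)})_i,\dots,(a_k^{(i)})_i)$ is the tuple $(a_1^{(1)},\dots,a_1^{(m)})$ with its $i'$-th entry replaced by $g(a_1^{(i_1)},\dots,a_k^{(i_k)})$; it sends a homomorphism $\zeta=(\zeta^{(i)})_{i\in[m]}$ to $\zeta^{(1)}\times\dots\times\zeta^{(m)}$. $\mathsf{MSAlg}^+(\mathcal{G})$ is the full subcategory of multisorted $\mathcal{G}$-algebras with all sorts nonempty, and $\mathsf{MSAlg}^\boxplus(\mathcal{G})$ its full subcategory where the sorts are moreover pairwise disjoint. $\mathsf{DAlg}^+(\hat{\mathcal{G}})$ is the full subcategory of $\mathsf{Alg}(\hat{\mathcal{G}})$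 whose objects are the algebras $\mathfrak{P}(\mathbf{M})$ with all sorts of $\mathbf{M}$ nonempty, and $\mathsf{DAlg}^\boxplus(\hat{\mathcal{G}})$ its full subcategory of those $\mathfrak{P}(\mathbf{M})$ with pairwise disjoint sorts. $\overline{\mathsf{DAlg}}^{\,+}(\hat{\mathcal{G}})$ is the full subcategory of $\mathsf{Alg}(\hat{\mathcal{G}})$ whose objects are the nonempty members of the variety $\mathcal{D}(\hat{\mathcal{G}})$ of all isomorphic copies of algebras of the form $\mathfrak{P}(\mathbf{M})$. *)

(* Defs.v *)
From mathcomp Require Import all_boot.
From mathcomp Require Import boolp.
Set Implicit Arguments.
Unset Strict Implicit.
Unset Printing Implicit Defensive.

(* The strict isomorphisms of categories considered below need the factors of
   a nonempty cartesian product to be determined by the product, and the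
   disjointness of sorts compares elements of distinct carriers.  Neither makes
   sense for Rocq types, so carriers are sets of Zermelo-Fraenkel set theory,
   in Aczel's model: well-founded trees up to extensional equality. *)
Inductive tree : Type := Node (T : Type) of T -> tree.

Fixpoint tree_eq (s t : tree) : Prop :=
  match s, t with
  | Node T f, Node U g =>
      (forall i, exists j, tree_eq (f i) (g j)) /\
      (forall j, exists i, tree_eq (f i) (g j))
  end.

Record zfset : Type := ZFSet {
  zf_class : tree -> Prop;
  zf_classP : exists t, zf_class = tree_eq t }.

Definition zf_of_tree (t : tree) : zfset :=
  ZFSet (ex_intro (fun s => tree_eq t = tree_eq s) t erefl).

Definition zf_repr (x : zfset) : tree := sval (cid (zf_classP x)).

Definition idx (x : zfset) : Type := let: Node T _ := zf_repr x in T.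

Definition elt (x : zfset) : idx x -> zfset :=
  match zf_repr x as t return (let: Node T _ := t in T) -> zfset with
  | Node T f => fun i => zf_of_tree (f i)
  end.

Definition zf_in (x y : zfset) : Prop := exists i : idx y, x = elt i.

(* replacement: the set {f i | i : T} *)
Definition zf_range (T : Type) (f : T -> zfset) : zfset :=
  zf_of_tree (Node (fun i => zf_repr (f i))).

Lemma tree_eq_refl t : tree_eq t t.
Proof. by elim: t => T f IH /=; split=> i; exists i. Qed.

Lemma tree_eq_sym s t : tree_eq s t -> tree_eq t s.
Proof.
elim: s t => T f IH [U g] /= [fg gf]; split.
- by move=> j; have [i /IH] := gf j; exists i.
- by move=> i; have [j /IH] := fg i; exists j.
Qed.

Lemma tree_eq_trans s t u : tree_eq s t -> tree_eq t u -> tree_eq s u.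
Proof.
elim: s t u => T f IH [U g] [K h] /= [fg gf] [gh hg]; split.
- by move=> i; have [j fgij] := fg i; have [k ghjk] := gh j; exists k;
    apply: IH fgij ghjk.
- by move=> k; have [j ghjk] := hg k; have [i fgij] := gf j; exists i;
    apply: IH fgij ghjk.
Qed.

Lemma tree_eq_class s t : tree_eq s t -> tree_eq s = tree_eq t.
Proof.
move=> st; apply: funext => u; apply: propext; split.
  exact: tree_eq_trans (tree_eq_sym st).
exact: tree_eq_trans.
Qed.

Lemma zfset_eq (x y : zfset) : zf_class x = zf_class y -> x = y.
Proof.
case: x y => [c cP] [c' c'P] /= e; case: c' / e c'P => c'P.
by rewrite (Prop_irrelevance cP c'P).
Qed.

Lemma zf_of_tree_eq s t : zf_of_tree s = zf_of_tree t <-> tree_eq s t.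
Proof.
split=> [/(congr1 zf_class) /= -> |/tree_eq_class e]; last exact: zfset_eq.
exact: tree_eq_refl.
Qed.

Lemma zf_reprK x : zf_of_tree (zf_repr x) = x.
Proof.
by apply: zfset_eq; rewrite /zf_repr /=; case: cid.
Qed.

Lemma zf_in_node T (f : T -> tree) x :
  zf_in x (zf_of_tree (Node f)) <-> exists i, x = zf_of_tree (f i).
Proof.
have := zf_reprK (zf_of_tree (Node f)); rewrite /zf_in /elt /idx.
case: (zf_repr _) => U g /zf_of_tree_eq /= [gf fg]; split=> [[j ->]|[i ->]].
  by have [i /zf_of_tree_eq gfji] := gf j; exists i.
by have [j /zf_of_tree_eq gfji] := fg i; exists j.
Qed.

Lemma zf_in_range T (f : T -> zfset) x :
  zf_in x (zf_range f) <-> exists i, x = f i.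
Proof.
rewrite zf_in_node.
by split=> -[i ->]; exists i; rewrite zf_reprK.
Qed.

Lemma zf_ext x y : (forall z, zf_in z x <-> zf_in z y) -> x = y.
Proof.
rewrite -(zf_reprK x) -(zf_reprK y).
case: (zf_repr x) (zf_repr y) => T f [U g] xy; apply/zf_of_tree_eq => /=.
split=> [i|j].
  have /xy/zf_in_node[j e] : zf_in (zf_of_tree (f i)) (zf_of_tree (Node f)).
    by apply/zf_in_node; exists i.
  by exists j; apply/zf_of_tree_eq.
have /xy/zf_in_node[i e] : zf_in (zf_of_tree (g j)) (zf_of_tree (Node g)).
  by apply/zf_in_node; exists j.
by exists i; apply/zf_of_tree_eq.
Qed.

Definition zf_empty : zfset := zf_range (fun e : void => match e with end).
Definition zf_unordered (x y : zfset) : zfset :=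
  zf_range (fun b : bool => if b then x else y).
Definition zf_pair (x y : zfset) : zfset :=
  zf_unordered (zf_unordered x x) (zf_unordered x y).
Fixpoint zf_num (n : nat) : zfset :=
  if n is k.+1 then zf_unordered (zf_num k) (zf_num k) else zf_empty.

(* an m-tuple is a function on {0, ..., m-1}, i.e. a set of ordered pairs *)
Definition zf_tuple (m : nat) (a : 'I_m -> zfset) : zfset :=
  zf_range (fun i : 'I_m => zf_pair (zf_num i) (a i)).

Lemma zf_in_unordered z x y : zf_in z (zf_unordered x y) <-> z = x \/ z = y.
Proof.
rewrite zf_in_range; split=> [[[] ->]|[->|->]]; [by left|by right| |].
  by exists true.
by exists false.
Qed.

Lemma zf_unorderedP x y u v : zf_unordered x y = zf_unordered u v ->
  (x = u /\ y = v) \/ (x = v /\ y = u).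
Proof.
move=> e; have E z : (z = x \/ z = y) <-> (z = u \/ z = v).
  by rewrite -!zf_in_unordered e.
have [/(_ (or_introl erefl)) xuv _] := E x.
have [/(_ (or_intror erefl)) yuv _] := E y.
have [_ /(_ (or_introl erefl)) uxy] := E u.
have [_ /(_ (or_intror erefl)) vxy] := E v.
by case: xuv yuv uxy vxy => ? [] ? [] ? [] ?; subst; auto.
Qed.

Lemma zf_pair_inj x y u v : zf_pair x y = zf_pair u v -> x = u /\ y = v.
Proof.
case/zf_unorderedP=> -[/zf_unorderedP xu /zf_unorderedP yv].
  by case: xu yv => -[-> _] [] [] // -> ->.
by case: xu yv => -[-> ->] [] [] ? ?; subst.
Qed.

Lemma zf_num_inj n k : zf_num n = zf_num k -> n = k.
Proof.
have nz x : zf_empty <> zf_unordered x x.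
  move=> e; have : zf_in x zf_empty by rewrite e zf_in_unordered; left.
  by rewrite zf_in_range => -[].
elim: n k => [|n IH] [|k] //= e; first by case: (nz _ e).
  by case: (nz _ (esym e)).
by case: (zf_unorderedP e) => -[/IH -> _].
Qed.

Lemma zf_tuple_inj m (a b : 'I_m -> zfset) : zf_tuple a = zf_tuple b -> a = b.
Proof.
move=> e; apply: funext => i.
have : zf_in (zf_pair (zf_num i) (a i)) (zf_tuple b).
  by rewrite -e zf_in_range; exists i.
by rewrite zf_in_range => -[j /zf_pair_inj[/zf_num_inj/ord_inj <- ->]].
Qed.

Definition El (X : zfset) : Type := {x : zfset | zf_in x X}.

Lemma El_inj X (x y : El X) : sval x = sval y -> x = y.
Proof. by case: x y => [x hx] [y hy] /=; apply: eq_exist. Qed.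

Definition zf_prod (m : nat) (X : 'I_m -> zfset) : zfset :=
  zf_range (fun c : forall i, idx (X i) => zf_tuple (fun i => elt (c i))).

Lemma zf_in_prod m (X : 'I_m -> zfset) x :
  zf_in x (zf_prod X) <->
  exists a : forall i, El (X i), x = zf_tuple (fun i => sval (a i)).
Proof.
rewrite zf_in_range; split=> [[c ->]|[a ->]].
  by exists (fun i => exist _ (elt (c i)) (ex_intro _ (c i) erefl)).
exists (fun i => sval (cid (svalP (a i)))); congr zf_tuple.
by apply: funext => i; case: cid.
Qed.

Definition mktup (m : nat) (X : 'I_m -> zfset) (a : forall i, El (X i)) :
    El (zf_prod X) :=
  exist _ (zf_tuple (fun i => sval (a i)))
    ((zf_in_prod X _).2 (ex_intro _ a erefl)).

Definition entry (m : nat) (X : 'I_m -> zfset) (x : El (zf_prod X)) :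
    forall i, El (X i) :=
  sval (cid ((zf_in_prod X _).1 (svalP x))).

Lemma entryK m (X : 'I_m -> zfset) (x : El (zf_prod X)) : mktup (entry x) = x.
Proof. by apply: El_inj; rewrite /entry /=; case: cid. Qed.

Lemma mktupK m (X : 'I_m -> zfset) (a : forall i, El (X i)) :
  entry (mktup a) = a.
Proof.
have /(congr1 sval)/zf_tuple_inj e := entryK (mktup a).
by apply: functional_extensionality_dep => i; apply: El_inj;
  have := congr1 (fun f => f i) e.
Qed.

Record category : Type := Category {
  obj :> Type;
  hom : obj -> obj -> Type;
  idm : forall x, hom x x;
  compm : forall x y z, hom y z -> hom x y -> hom x z;
  comp1m : forall x y (f : hom x y), compm (idm y) f = f;
  compm1 : forall x y (f : hom x y), compm f (idm x) = f;
  compA : forall x y z w (h : hom z w) (g : hom y z) (f : hom x y),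
    compm h (compm g f) = compm (compm h g) f }.
Arguments hom {c} x y.
Arguments idm {c} x.
Arguments compm {c x y z} g f.

Record functor (C D : category) : Type := Functor {
  fobj :> C -> D;
  fmap : forall x y : C, hom x y -> hom (fobj x) (fobj y);
  fmap1 : forall x, fmap (idm x) = idm (fobj x);
  fmapM : forall x y z (g : hom y z) (f : hom x y),
    fmap (compm g f) = compm (fmap g) (fmap f) }.
Arguments fmap {C D} F {x y} f : rename.

Definition functor_id (C : category) : functor C C :=
  @Functor C C id (fun _ _ => id) (fun _ => erefl) (fun _ _ _ _ _ => erefl).

Lemma functor_comp1 C D E (G : functor D E) (F : functor C D) (x : C) :
  fmap G (fmap F (idm x)) = idm (G (F x)).
Proof. by rewrite !fmap1. Qed.

Lemma functor_compM C D E (G : functor D E) (F : functor C D) (x y z : C)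
    (g : hom y z) (f : hom x y) :
  fmap G (fmap F (compm g f)) = compm (fmap G (fmap F g)) (fmap G (fmap F f)).
Proof. by rewrite !fmapM. Qed.

Definition functor_comp (C D E : category) (G : functor D E) (F : functor C D) :
    functor C E :=
  @Functor C E (fun x => G (F x)) (fun _ _ f => fmap G (fmap F f))
    (functor_comp1 G F) (functor_compM G F).

Definition is_iso (C : category) (x y : C) (f : hom x y) : Prop :=
  exists g : hom y x, compm g f = idm x /\ compm f g = idm y.

Definition isomorphic (C : category) (x y : C) : Prop :=
  exists f : hom x y, is_iso f.

Definition nat_isomorphic (C D : category) (F G : functor C D) : Prop :=
  exists eta : forall x, hom (F x) (G x),
    (forall x y (f : hom x y),
       compm (eta y) (fmap F f) = compm (fmap G f) (eta x)) /\
    (forall x, is_iso (eta x)).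

Definition equivalent_categories (C D : category) : Prop :=
  exists (F : functor C D) (G : functor D C),
    nat_isomorphic (functor_comp G F) (functor_id C) /\
    nat_isomorphic (functor_comp F G) (functor_id D).

(* Leibniz equality of functors, not natural isomorphism. *)
Definition is_cat_iso (C D : category) (F : functor C D) : Prop :=
  exists G : functor D C,
    functor_comp G F = functor_id C /\ functor_comp F G = functor_id D.

Definition full_subcategory (C : category) (P : C -> Prop) : category :=
  @Category {x : C | P x} (fun x y => hom (sval x) (sval y))
    (fun x => idm (sval x)) (fun _ _ _ g f => compm g f)
    (fun x y f => comp1m f) (fun x y f => compm1 f)
    (fun _ _ _ _ h g f => compA h g f).

Definition restrict_functor (C D : category) (F : functor C D)
    (P : C -> Prop) (Q : D -> Prop) (PQ : forall x, P x -> Q (F x)) :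
    functor (full_subcategory P) (full_subcategory Q) :=
  @Functor (full_subcategory P) (full_subcategory Q)
    (fun x => exist Q (F (sval x)) (PQ _ (svalP x))) (fun _ _ f => fmap F f)
    (fun x => fmap1 F (sval x)) (fun _ _ _ g f => fmapM F g f).

Record language : Type := Language {
  sym : Type;
  ar : sym -> nat }.

Record algebra (L : language) : Type := Algebra {
  carrier : zfset;
  op : forall s : sym L, ('I_(ar s) -> El carrier) -> El carrier }.
Arguments op {L} A s a : rename.

Definition is_alg_hom (L : language) (A B : algebra L)
    (f : El (carrier A) -> El (carrier B)) : Prop :=
  forall s a, f (op A s a) = op B s (fun j => f (a j)).

Definition alg_hom (L : language) (A B : algebra L) : Type :=
  {f | @is_alg_hom L A B f}.

Lemma alg_hom_eq L (A B : algebra L) (f g : alg_hom A B) :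
  sval f = sval g -> f = g.
Proof. by case: f g => [f hf] [g hg] /=; apply: eq_exist. Qed.

Definition alg_id L (A : algebra L) : alg_hom A A :=
  exist (@is_alg_hom L A A) id (fun _ _ => erefl).

Lemma alg_comp_subproof L (A B C : algebra L) (g : alg_hom B C)
    (f : alg_hom A B) s a :
  sval g (sval f (op A s a)) = op C s (fun j => sval g (sval f (a j))).
Proof. by rewrite (svalP f) (svalP g). Qed.

Definition alg_comp L (A B C : algebra L) (g : alg_hom B C) (f : alg_hom A B) :
    alg_hom A C :=
  exist (@is_alg_hom L A C) (fun x => sval g (sval f x))
    (alg_comp_subproof g f).

Definition Alg (L : language) : category.
Proof.
refine (@Category (algebra L) (@alg_hom L) (@alg_id L) (@alg_comp L) _ _ _);
  abstract by move=> *; apply: alg_hom_eq.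
Defined.

Record mlanguage (m : nat) : Type := MLanguage {
  msym : Type;
  mar : msym -> nat;
  insort : forall g : msym, 'I_(mar g) -> 'I_m;
  outsort : msym -> 'I_m }.
Arguments insort {m m0} g j : rename.

Definition no_nullary m (G : mlanguage m) : Prop :=
  forall g : msym G, 0 < mar g.

Record malgebra m (G : mlanguage m) : Type := MAlgebra {
  msort : 'I_m -> zfset;
  mop : forall g : msym G,
    (forall j : 'I_(mar g), El (msort (insort g j))) -> El (msort (outsort g)) }.
Arguments msort {m G} M i : rename.
Arguments mop {m G} M g a : rename.

Definition is_malg_hom m (G : mlanguage m) (M N : malgebra G)
    (z : forall i, El (msort M i) -> El (msort N i)) : Prop :=
  forall g a, z (outsort g) (mop M g a) =
              mop N g (fun j => z (insort g j) (a j)).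

Definition malg_hom m (G : mlanguage m) (M N : malgebra G) : Type :=
  {z | @is_malg_hom m G M N z}.

Lemma malg_hom_eq m (G : mlanguage m) (M N : malgebra G) (f g : malg_hom M N) :
  sval f = sval g -> f = g.
Proof. by case: f g => [f hf] [g hg] /=; apply: eq_exist. Qed.

Definition malg_id m (G : mlanguage m) (M : malgebra G) : malg_hom M M :=
  exist (@is_malg_hom m G M M) (fun _ => id) (fun _ _ => erefl).

Lemma malg_comp_subproof m (G : mlanguage m) (M N K : malgebra G)
    (y : malg_hom N K) (z : malg_hom M N) (g : msym G) a :
  sval y _ (sval z (outsort g) (mop M g a)) =
  mop K g (fun j => sval y _ (sval z _ (a j))).
Proof. by rewrite (svalP z) (svalP y). Qed.

Definition malg_comp m (G : mlanguage m) (M N K : malgebra G)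
    (y : malg_hom N K) (z : malg_hom M N) : malg_hom M K :=
  exist (@is_malg_hom m G M K) (fun i x => sval y i (sval z i x))
    (malg_comp_subproof y z).

Definition MSAlg m (G : mlanguage m) : category.
Proof.
refine (@Category (malgebra G) (@malg_hom m G) (@malg_id m G)
  (@malg_comp m G) _ _ _); abstract by move=> *; apply: malg_hom_eq.
Defined.

(* None is the diagonal symbol d, and Some g is the symbol written g-hat. *)
Definition hat m (G : mlanguage m) : language :=
  @Language (option (msym G)) (fun s => if s is Some g then mar g else m).

Section DiagonalAlgebra.
Variables (m : nat) (G : mlanguage m) (hG : no_nullary G).

Definition diag_op (M : malgebra G) (a : 'I_m -> El (zf_prod (msort M))) :
    El (zf_prod (msort M)) :=
  mktup (fun i => entry (a i) i).

Definition hat_op (M : malgebra G) (g : msym G)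
    (a : 'I_(mar g) -> El (zf_prod (msort M))) : El (zf_prod (msort M)) :=
  mktup (dfwith (entry (a (Ordinal (hG g))))
                (mop M g (fun j => entry (a j) (insort g j)))).

Definition diag_algebra (M : malgebra G) : algebra (hat G) :=
  @Algebra (hat G) (zf_prod (msort M))
    (fun s => match s return
         ('I_(@ar (hat G) s) -> El (zf_prod (msort M))) -> El (zf_prod (msort M))
       with
       | None => @diag_op M
       | Some g => @hat_op M g
       end).

Definition prod_map (M N : malgebra G) (z : malg_hom M N)
    (x : El (zf_prod (msort M))) : El (zf_prod (msort N)) :=
  mktup (fun i => sval z i (entry x i)).

Lemma prod_map_hom (M N : malgebra G) (z : malg_hom M N) (s : sym (hat G)) a :
  prod_map z (op (diag_algebra M) s a) =
  op (diag_algebra N) s (fun j => prod_map z (a j)).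
Proof.
case: s a => [g|] a; rewrite /prod_map /=; congr mktup;
  apply: functional_extensionality_dep => i; last by rewrite !mktupK.
rewrite !mktupK.
case: dfwithP => [|j ne]; last by rewrite dfwith_out.
rewrite dfwith_in (svalP z); congr mop.
by apply: functional_extensionality_dep => j; rewrite mktupK.
Qed.

Definition diag_map (M N : malgebra G) (z : malg_hom M N) :
    alg_hom (diag_algebra M) (diag_algebra N) :=
  exist (@is_alg_hom _ (diag_algebra M) (diag_algebra N)) (@prod_map M N z)
    (prod_map_hom z).

Lemma diag_map1 (M : malgebra G) :
  diag_map (malg_id M) = alg_id (diag_algebra M).
Proof.
by apply: alg_hom_eq; apply: funext => x; rewrite /= /prod_map /= entryK.
Qed.

Lemma diag_mapM (M N K : malgebra G) (y : malg_hom N K) (z : malg_hom M N) :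
  diag_map (malg_comp y z) = alg_comp (diag_map y) (diag_map z).
Proof.
by apply: alg_hom_eq; apply: funext => x; rewrite /= /prod_map mktupK.
Qed.

Definition diag_functor : functor (MSAlg G) (Alg (hat G)) :=
  @Functor (MSAlg G) (Alg (hat G)) diag_algebra diag_map diag_map1 diag_mapM.

Definition nonempty_sorts (M : MSAlg G) : Prop :=
  forall i : 'I_m, exists x, zf_in x (msort M i).

Definition disjoint_sorts (M : MSAlg G) : Prop :=
  forall i j : 'I_m, i != j ->
    ~ exists x, zf_in x (msort M i) /\ zf_in x (msort M j).

Definition MSAlg_plus : category := full_subcategory nonempty_sorts.

Definition MSAlg_boxplus : category :=
  full_subcategory (fun M : MSAlg_plus => disjoint_sorts (sval M)).

Definition is_DAlg_plus (A : Alg (hat G)) : Prop :=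
  exists M : MSAlg G, nonempty_sorts M /\ A = diag_functor M.

Definition DAlg_plus : category := full_subcategory is_DAlg_plus.

Definition is_DAlg_boxplus (A : DAlg_plus) : Prop :=
  exists M : MSAlg G,
    [/\ nonempty_sorts M, disjoint_sorts M & sval A = diag_functor M].

Definition DAlg_boxplus : category := full_subcategory is_DAlg_boxplus.

(* The sorts of M may be empty here. *)
Definition in_variety_D (A : Alg (hat G)) : Prop :=
  exists M : MSAlg G, isomorphic A (diag_functor M).

Definition DAlg_bar_plus : category :=
  full_subcategory (fun A : Alg (hat G) =>
    (exists x, zf_in x (carrier A)) /\ in_variety_D A).

End DiagonalAlgebra.

(* Main.v *)
(** Put [x] at position [i] and [y] at all other positions of the diagonal
    operation: the result has the [i]-th entry of [x] and agrees with [y]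
    elsewhere.  Hence a homomorphism between diagonal algebras sends tuples with
    equal [i]-th entries to tuples with equal [i]-th entries, so it acts
    entrywise, and over nonempty sorts the diagonal functor is fully faithful.
    A nonempty product determines its factors and the diagonal algebra
    determines the operations, so the functor is also injective on objects,
    which upgrades the equivalence to an isomorphism onto the image. *)
Require Import Defs.
From mathcomp Require Import all_boot.
From mathcomp Require Import boolp.
Set Implicit Arguments.
Unset Strict Implicit.
Unset Printing Implicit Defensive.

(** By proof irrelevance the equation between the first components is [erefl], so transport along it
    is trivial. *)
Lemma existT_injr (T : Type) (P : T -> Type) (x : T) (a b : P x) :
  existT P x a = existT P x b -> a = b.
Proof.
move=> e; have := projT2_eq e.
by rewrite (Prop_irrelevance (projT1_eq e) erefl).
Qed.

(** * Fully faithful functors and equivalences *)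

Definition fully_faithful (C D : category) (F : functor C D) : Prop :=
  forall (x y : C) (h : hom (F x) (F y)), exists! f : hom x y, fmap F f = h.

Lemma fully_faithful_inj C D (F : functor C D) (x y : C) (f g : hom x y) :
  fully_faithful F -> fmap F f = fmap F g -> f = g.
Proof.
by move=> ff e; have [h [_ u]] := ff _ _ (fmap F g); rewrite -(u f e) -(u g).
Qed.

(** Choice picks [g y] with an isomorphism [e y] from [y] to [F (g y)]. Conjugating arrows by these
    and lifting them through [F] makes [g] a functor; equations between lifts are checked after
    applying [F]. *)
Lemma equivalent_of_fully_faithful C D (F : functor C D) :
  fully_faithful F -> (forall y : D, exists x : C, isomorphic y (F x)) ->
  equivalent_categories C D.
Proof.
move=> ff /choice[g giso].
pose e y := sval (cid (giso y)).
pose e' y := sval (cid (svalP (cid (giso y)))).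
have [eV eK] : (forall y, compm (e' y) (e y) = idm y) /\
    (forall y, compm (e y) (e' y) = idm (F (g y))).
  by split=> y; have [] := svalP (cid (svalP (cid (giso y)))).
pose pre x y (h : hom (F x) (F y)) := sval (cid (ff x y h)).
have preK x y (h : hom (F x) (F y)) : fmap F (pre x y h) = h.
  by rewrite /pre; case: cid => ? [].
pose gm y z (f : hom y z) := pre (g y) (g z) (compm (e z) (compm f (e' y))).
have gm1 y : gm y y (idm y) = idm (g y).
  by apply: (fully_faithful_inj ff); rewrite preK fmap1 comp1m eK.
have gmM x y z (b : hom y z) (a : hom x y) :
    gm x z (compm b a) = compm (gm y z b) (gm x y a).
  apply: (fully_faithful_inj ff); rewrite fmapM !preK !Defs.compA.
  by rewrite -(Defs.compA _ (e' y)) eV compm1.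
exists F, (@Functor D C g gm gm1 gmM); split.
  (* The component at [x] is the lift of [e' (F x)]; its inverse will be the lift of [e (F x)]. *)
  exists (fun x => pre (g (F x)) x (e' (F x))); split=> [x y f|x] /=.
    by apply: (fully_faithful_inj ff); rewrite !fmapM !preK !Defs.compA eV comp1m.
  exists (pre x (g (F x)) (e (F x))).
  by split; apply: (fully_faithful_inj ff); rewrite fmapM !preK fmap1.
exists e'; split=> [x y f|y] /=; first by rewrite preK !Defs.compA eV comp1m.
by exists (e y).
Qed.

(** * Equality of functors and isomorphisms of categories *)

(* Bundling the endpoints lets arrows with provably equal, but not convertible,
   endpoints be compared with Leibniz equality. *)
Definition arrow (C : category) : Type := {p : C * C & hom p.1 p.2}.

Definition arr (C : category) (x y : C) (f : hom x y) : arrow C :=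
  existT (fun p : C * C => hom p.1 p.2) (x, y) f.

Lemma arr_inj (C : category) (x y : C) (f g : hom x y) : arr f = arr g -> f = g.
Proof. exact: existT_injr. Qed.

Lemma arr_eq_ends (C : category) (x y x' y' : C) (f : hom x y) (f' : hom x' y') :
  arr f = arr f' -> x = x' /\ y = y'.
Proof. by move=> /(congr1 tag)[]. Qed.

Lemma arr_idm (C : category) (x y : C) : x = y -> arr (idm x) = arr (idm y).
Proof. by move->. Qed.

Lemma arr_compm (C : category) (x y z x' y' z' : C)
    (g : hom y z) (f : hom x y) (g' : hom y' z') (f' : hom x' y') :
  arr g = arr g' -> arr f = arr f' -> arr (compm g f) = arr (compm g' f').
Proof.
move=> eg ef; have [ex ey] := arr_eq_ends ef; have [_ ez] := arr_eq_ends eg.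
by move: g' f' eg ef; case: _ / ex; case: _ / ey; case: _ / ez => g' f'
  /arr_inj -> /arr_inj ->.
Qed.

Lemma arr_cast (C : category) (x y x' y' : C) (f : hom x y) :
  x = x' -> y = y' -> exists f' : hom x' y', arr f' = arr f.
Proof. by move=> <- <-; exists f. Qed.

(** On identities, comparing endpoints identifies the object maps. After that the arrow maps have
    the same type, and the functor laws agree by proof irrelevance. *)
Lemma functor_eq C D (F G : functor C D) :
  (forall (x y : C) (f : hom x y), arr (fmap F f) = arr (fmap G f)) -> F = G.
Proof.
move=> FG; have e : fobj F = fobj G.
  by apply: funext => x; have [] := arr_eq_ends (FG _ _ (idm x)).
case: F G e FG => [F Fm F1 FM] [G Gm G1 GM] /= e.
case: _ / e Gm G1 GM => Gm G1 GM FG.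
have e : Fm = Gm.
  apply: functional_extensionality_dep => x.
  apply: functional_extensionality_dep => y.
  by apply: funext => f; apply: arr_inj; apply: FG.
case: _ / e G1 GM {FG} => G1 GM.
by rewrite (Prop_irrelevance F1 G1) (Prop_irrelevance FM GM).
Qed.

Lemma arr_fmap_inj C D (F : functor C D) (x y x' y' : C)
    (f : hom x y) (f' : hom x' y') :
  fully_faithful F -> injective F -> arr (fmap F f) = arr (fmap F f') ->
  arr f = arr f'.
Proof.
move=> ff Finj e; have [/Finj ex /Finj ey] := arr_eq_ends e.
by move: f' e; case: _ / ex; case: _ / ey => f'
  /arr_inj/(fully_faithful_inj ff) ->.
Qed.

(** The inverse takes an arrow from [y] to [z], transports it along [F (g y) = y] and [F (g z) = z],
    and lifts it through [F]. *)
Lemma is_cat_iso_of_bijective C D (F : functor C D) :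
  fully_faithful F -> injective F -> (forall y : D, exists x : C, F x = y) ->
  is_cat_iso F.
Proof.
move=> ff Finj /choice[g gK].
have lift y z (f : hom y z) : exists h : hom (g y) (g z), arr (fmap F h) = arr f.
  have [f' <-] := arr_cast f (esym (gK y)) (esym (gK z)).
  by have [h [<- _]] := ff _ _ f'; exists h.
pose gm y z (f : hom y z) := sval (cid (lift y z f)).
have gmK y z (f : hom y z) : arr (fmap F (gm y z f)) = arr f.
  by rewrite /gm; case: cid.
have gm1 y : gm y y (idm y) = idm (g y).
  by apply/arr_inj/(arr_fmap_inj ff Finj); rewrite gmK fmap1; apply: arr_idm.
have gmM x y z (b : hom y z) (a : hom x y) :
    gm x z (compm b a) = compm (gm y z b) (gm x y a).
  apply/arr_inj/(arr_fmap_inj ff Finj); rewrite gmK fmapM.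
  by apply: arr_compm; rewrite gmK.
exists (@Functor D C g gm gm1 gmM); split; apply: functor_eq => x y f /=.
  by apply: (arr_fmap_inj ff Finj); rewrite gmK.
exact: gmK.
Qed.

(** The type of [op] depends on the carrier, so the operations are extracted as the second component
    of a dependent pair. *)
Lemma algebra_eq_op L (X : zfset)
    (o o' : forall s : sym L, ('I_(ar s) -> El X) -> El X) :
  Algebra o = Algebra o' -> o = o'.
Proof.
move=> e; pose P X := forall s : sym L, ('I_(ar s) -> El X) -> El X.
apply: (@existT_injr _ P X).
by have := congr1 (fun A : algebra L => existT P (carrier A) (@op L A)) e.
Qed.

(** * Factors of a nonempty product *)

Section Products.
Variables (m : nat).

Lemma mktup_inj (X : 'I_m -> zfset) (a b : forall i, El (X i)) :
  mktup a = mktup b -> a = b.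
Proof. by move=> e; rewrite -(mktupK a) e mktupK. Qed.

(** An element of [X i], padded by [e], gives a tuple in the common product, and a tuple determines
    its entries. *)
Lemma zf_prod_factor_sub (X Y : 'I_m -> zfset) (e : forall i, El (X i)) :
  zf_prod X = zf_prod Y -> forall i x, zf_in x (X i) -> zf_in x (Y i).
Proof.
move=> XY i x xX; pose a := dfwith e (exist (fun x => zf_in x (X i)) x xX).
have : zf_in (zf_tuple (fun j => sval (a j))) (zf_prod Y).
  by rewrite -XY zf_in_prod; exists a.
rewrite zf_in_prod => -[b /zf_tuple_inj/(congr1 (fun f => f i))].
by rewrite /a dfwith_in /= => ->; apply: (svalP (b i)).
Qed.

Lemma zf_prod_inj (X Y : 'I_m -> zfset) :
  (forall i, El (X i)) -> (forall i, El (Y i)) -> zf_prod X = zf_prod Y -> X = Y.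
Proof.
move=> eX eY XY; apply: funext => i; apply: zf_ext => x.
split; first exact: (zf_prod_factor_sub eX XY).
exact: (zf_prod_factor_sub eY (esym XY)).
Qed.

End Products.

(** * Full faithfulness and injectivity of the diagonal functor *)

Section DiagonalFunctor.
Variables (m : nat) (G : mlanguage m) (hG : no_nullary G).

Lemma nonempty_sorts_point (M : malgebra G) :
  nonempty_sorts M -> forall i, El (msort M i).
Proof. by move=> h i; have [x xi] := cid (h i); exists x. Qed.

(** Arguments of [g] live in various sorts; padding each by the base point [e] makes them tuples,
    and [mop M g a] is then read off at entry [outsort g]. *)
Lemma hat_op_dfwith (M : malgebra G) (e : forall i, El (msort M i)) (g : msym G)
    (a : forall j : 'I_(mar g), El (msort M (insort g j))) :
  hat_op hG (fun j => mktup (dfwith e (a j))) =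
    mktup (dfwith (dfwith e (a (Ordinal (hG g)))) (mop M g a)).
Proof.
rewrite /hat_op mktupK; congr (mktup (dfwith _ (mop M g _))).
by apply: functional_extensionality_dep => j; rewrite mktupK dfwith_in.
Qed.

Lemma diag_hom_entry (M N : malgebra G)
    (f : alg_hom (diag_algebra hG M) (diag_algebra hG N)) i x y :
  entry x i = entry y i -> entry (sval f x) i = entry (sval f y) i.
Proof.
move=> xy; pose a j := if j == i then x else y.
have -> : y = op (diag_algebra hG M) None a.
  rewrite -[LHS]entryK /= /diag_op; congr mktup.
  apply: functional_extensionality_dep => j.
  by rewrite /a; case: eqP => // ->.
by rewrite (svalP f) /= /diag_op mktupK /a eqxx.
Qed.

Lemma diag_map_surj (M N : malgebra G) :
  nonempty_sorts M ->
  forall f : alg_hom (diag_algebra hG M) (diag_algebra hG N),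
  exists z, diag_map hG z = f.
Proof.
move=> /nonempty_sorts_point e f.
(* The choice of padding [e] is immaterial: [zE] holds because entry [i] of [f x] depends only on
   entry [i] of [x]. *)
pose z i (u : El (msort M i)) := entry (sval f (mktup (dfwith e u))) i.
have zE x i : z i (entry x i) = entry (sval f x) i.
  by apply: diag_hom_entry; rewrite mktupK dfwith_in.
have zh : @is_malg_hom m G M N z.
  move=> g a; pose x j := mktup (dfwith e (a j)).
  have -> : mop M g a = entry (op (diag_algebra hG M) (Some g) x) (outsort g).
    by rewrite /= hat_op_dfwith mktupK dfwith_in.
  by rewrite zE (svalP f) /= /hat_op mktupK dfwith_in.
exists (exist _ z zh); apply: alg_hom_eq; apply: funext => x /=.
rewrite /prod_map /= -[RHS]entryK; congr mktup.
by apply: functional_extensionality_dep => i; rewrite zE.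
Qed.

Lemma diag_map_inj (M N : malgebra G) :
  nonempty_sorts M -> injective (@diag_map m G hG M N).
Proof.
move=> /nonempty_sorts_point e y z /(congr1 sval) yz; apply: malg_hom_eq.
apply: functional_extensionality_dep => i; apply: funext => u.
have /mktup_inj/(congr1 (fun f => f i)) := congr1 (@^~ (mktup (dfwith e u))) yz.
by rewrite mktupK dfwith_in.
Qed.

Lemma diag_map_bij (M N : malgebra G) :
  nonempty_sorts M ->
  forall f : alg_hom (diag_algebra hG M) (diag_algebra hG N),
  exists! z, diag_map hG z = f.
Proof.
move=> hM f; have [z <-] := diag_map_surj hM f.
by exists z; split=> // z' /(diag_map_inj hM).
Qed.

Lemma diag_algebra_inj (M N : malgebra G) :
  nonempty_sorts M -> nonempty_sorts N ->
  diag_algebra hG M = diag_algebra hG N -> M = N.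
Proof.
case: M N => [X o] [Y o'] /nonempty_sorts_point /= e /nonempty_sorts_point /= e'.
(* Once the sorts are recovered from the carrier, the operations are compared on padded tuples. *)
move=> MN; have XY : X = Y by apply: zf_prod_inj e e' (congr1 (@carrier _) MN).
case: _ / XY o' e' MN => o' e' /algebra_eq_op MN; congr MAlgebra.
apply: functional_extensionality_dep => g; apply: funext => a.
pose P := forall s : sym (hat G), ('I_(ar s) -> El (zf_prod X)) -> El (zf_prod X).
pose x (j : 'I_(mar g)) := mktup (dfwith e (a j)).
have : hat_op hG (M := MAlgebra o) x = hat_op hG (M := MAlgebra o') x.
  exact: (congr1 (fun q : P => q (Some g) x) MN).
rewrite (hat_op_dfwith (M := MAlgebra o)) (hat_op_dfwith (M := MAlgebra o')).
by move=> /mktup_inj/(congr1 (fun f => f (outsort g))); rewrite !dfwith_in.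
Qed.

Lemma nonempty_diag_algebra (M : malgebra G) :
  nonempty_sorts M <-> exists x, zf_in x (carrier (diag_algebra hG M)).
Proof.
split=> [/nonempty_sorts_point e|[x xM] i].
  by exists (sval (mktup e)); exact: (svalP (mktup e)).
have a := entry (exist (fun x => zf_in x (zf_prod (msort M))) x xM) i.
by exists (sval a); exact: (svalP a).
Qed.

Lemma diag_DAlg_bar (M : MSAlg G) : nonempty_sorts M ->
  (exists x, zf_in x (carrier (diag_functor hG M))) /\
  in_variety_D hG (diag_functor hG M).
Proof.
move=> hM; split; first exact: (nonempty_diag_algebra M).1 hM.
by exists M, (idm _), (idm _); rewrite comp1m.
Qed.

(** * The equivalence and the two isomorphisms *)

Lemma MSAlg_plus_equivalence :
  equivalent_categories (MSAlg_plus G) (DAlg_bar_plus hG).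
Proof.
apply: (equivalent_of_fully_faithful (F := restrict_functor diag_DAlg_bar)).
  by move=> [M hM] [N hN] /= f; apply: diag_map_bij.
move=> [A [[x xA] [M [f fiso]]]].
(* Membership in the variety allows empty sorts; the image under [f] of a point of [A] lies in the
   product and rules them out. *)
have hM : nonempty_sorts M.
  apply/nonempty_diag_algebra.
  pose y := sval f (exist (fun x => zf_in x (carrier A)) x xA).
  by exists (sval y); exact: (svalP y).
by exists (exist _ M hM), f.
Qed.

Lemma diag_DAlg_plus (M : MSAlg G) :
  nonempty_sorts M -> is_DAlg_plus hG (diag_functor hG M).
Proof. by exists M. Qed.

Lemma diag_DAlg_boxplus (M : MSAlg_plus G) : disjoint_sorts (sval M) ->
  is_DAlg_boxplus (restrict_functor diag_DAlg_plus M : DAlg_plus hG).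
Proof. by case: M => M hM /= dM; exists M. Qed.

Lemma diag_plus_iso : is_cat_iso (restrict_functor diag_DAlg_plus).
Proof.
apply: is_cat_iso_of_bijective.
- by move=> [M hM] [N hN] /= f; apply: diag_map_bij.
- move=> [M hM] [N hN] /(congr1 sval)/= /diag_algebra_inj MN.
  by apply: eq_exist; apply: MN.
(* Objects of the target are literally images, so [M] is a strict preimage; membership proofs agree
   by proof irrelevance. *)
- move=> [A [M [hM AM]]]; exists (exist _ M hM).
  exact: eq_exist.
Qed.

Lemma diag_boxplus_iso : is_cat_iso (restrict_functor diag_DAlg_boxplus).
Proof.
apply: is_cat_iso_of_bijective.
- by move=> [[M hM] dM] [[N hN] dN] /= f; apply: diag_map_bij.
- move=> [[M hM] dM] [[N hN] dN] /(congr1 (fun A => sval (sval A)))/=.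
  by move=> /diag_algebra_inj MN; do 2!apply: eq_exist; apply: MN.
- move=> [[A pA] [M [hM dM AM]]].
  exists (exist (fun M : MSAlg_plus G => disjoint_sorts (sval M))
                (exist _ M hM) dM).
  by do 2!apply: eq_exist.
Qed.

End DiagonalFunctor.

Theorem theorem2p7 (m : nat) (hm : 0 < m) (G : mlanguage m)
    (hG : no_nullary G) :
  equivalent_categories (MSAlg_plus G) (DAlg_bar_plus hG) /\
  exists maps_plus : forall M : MSAlg G,
      nonempty_sorts M -> is_DAlg_plus hG (diag_functor hG M),
    let P_plus : functor (MSAlg_plus G) (DAlg_plus hG) :=
      restrict_functor maps_plus in
    is_cat_iso P_plus /\
    exists maps_boxplus : forall M : MSAlg_plus G,
        disjoint_sorts (sval M) -> is_DAlg_boxplus (P_plus M),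
      let P_boxplus : functor (MSAlg_boxplus G) (DAlg_boxplus hG) :=
        restrict_functor maps_boxplus in
      is_cat_iso P_boxplus.
Proof.
split; first exact: MSAlg_plus_equivalence.
exists (@diag_DAlg_plus m G hG); split; first exact: diag_plus_iso.
by exists (@diag_DAlg_boxplus m G hG); exact: diag_boxplus_iso.
Qed.
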